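(* Let $\lambda$ be a partition. There exists a unique inner product $(-,-)_{\lambda}:\hat{S}_{\lambda}\times\hat{S}_{\lambda}\to\mathbb{F}$ such that $(e_{\tau_\lambda},e_{\tau_\lambda})_\lambda=1$ and, for all $i\ge1$, $T_i^*=T_i$ (that is, $(T_i v,w)_\lambda=(v,T_iw)_\lambda$ for all $v,w\in\hat S_\lambda$).
   Context: $\mathbb{F}$ is a field complete with respect to a nontrivial non-archimedean absolute value $|\cdot|$, and $t\in\mathbb{F}$ is fixed with $0<|t|<1$. An inner product on a Banach space $V$ over $\mathbb{F}$ is a non-degenerate continuous symmetric bilinear form $V\times V\to\mathbb{F}$. **Tableaux.** Partitions are finite weakly decreasing sequences $\lambda=(\lambda_1,\dots,\lambda_\ell)$ of positive integers (the empty partition is allowed, with $\lambda_1=0$), with $|\lambda|=\sum\lambda_i$. A diagram has boxes $(i,j)$ in row $i$ (counted from the top) and column $j$; the content of $(i,j)$ is $j-i$. Put $n_\lambda=|\lambda|+\lambda_1$, $\lambda^{(n)}=(n-|\lambda|,\lambda)$ for $n\ge n_\lambda$, and $\lambda^{(\infty)}=\bigcup_{n\ge n_\lambda}\lambda^{(n)}$ (infinite first row, then the rows of $\lambda$ below it). $\mathrm{SYT}_\infty(\lambda)$ is the set of bijective fillings $\tau:\lambda^{(\infty)}\to\{1,2,\dots\}$ strictly increasing left to right along rows and top to bottom down columns; $c_\tau(i)$ is the content of the box labeled $i$. $s_i(\tau)$ is $\tau$ with labels $i,i+1$ swapped. Write $s_i(\tau)>\tau$ if $i+1$ lies strictly to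 the right of and above $i$ in $\tau$, and $s_i(\tau)<\tau$ if $i$ lies strictly to the right of and above $i+1$ in $\tau$ (otherwise $i,i+1$ are in the same row or the same column). $\tau_\lambda\in\mathrm{SYT}_\infty(\lambda)$ is the column-standard tableau: the columns are filled consecutively from left to right, each from top to bottom (so if $\square_1$ is directly below $\square_2$ then $\tau_\lambda(\square_1)=\tau_\lambda(\square_2)+1$). **The space $\hat{S}_\lambda$.** $\hat{S}_\lambda=c_0(\mathrm{SYT}_\infty(\lambda))$ is the space of formal sums $\sum_\tau c_\tau e_\tau$, $c_\tau\in\mathbb{F}$, such that for every $c>0$ only finitely many $\tau$ have $|c_\tau|\ge c$, with norm $\sup_\tau|c_\tau|$. For $i\ge1$, $T_i$ is the continuous linear operator on $\hat S_\lambda$ with: - $T_ie_\tau=e_\tau$ if $i,i+1$ are in the same row of $\tau$; $T_ie_\tau=-te_\tau$ if in the same column; - if $s_i(\tau)>\tau$: $T_ie_\tau=e_{s_i(\tau)}+\frac{1-t}{1-t^{c_\tau(i+1)-c_\tau(i)}}e_\tau$; - if $s_i(\tau)<\tau$, with $d=c_\tau(i)-c_\tau(i+1)$: $T_ie_\tau=t\frac{(1-t^{d-1})(1-t^{d+1})}{(1-t^{d})^2}e_{s_i(\tau)}-t^{d}\frac{1-t}{1-t^{d}}e_\tau$. *)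

(* Defs.v *)
From HB Require Import structures.
From mathcomp Require Import all_boot all_order all_algebra.
From mathcomp Require Import mathcomp_extra boolp classical_sets functions.
From mathcomp Require Import cardinality reals zify.

Set Implicit Arguments.
Unset Strict Implicit.
Unset Printing Implicit Defensive.

Import Order.TTheory GRing.Theory Num.Theory.
Local Open Scope classical_set_scope.
Local Open Scope ring_scope.

Record nonarch_abs (R : realType) (F : fieldType) := NonarchAbs {
  nabs :> F -> R;
  nabs_ge0 : forall x, 0 <= nabs x;
  nabs_eq0 : forall x, nabs x = 0 <-> x = 0;
  nabsM : forall x y, nabs (x * y) = nabs x * nabs y;
  nabs_ultra : forall x y, nabs (x + y) <= Num.max (nabs x) (nabs y) }.

Definition nontrivial_abs (R : realType) (F : fieldType)
    (abs : nonarch_abs R F) : Prop :=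
  exists x, x != 0 /\ abs x != 1.

Definition complete_abs (R : realType) (F : fieldType)
    (abs : nonarch_abs R F) : Prop :=
  forall u : nat -> F,
    (forall e, 0 < e -> exists N, forall m n, (N <= m)%N -> (N <= n)%N ->
       abs (u m - u n) < e) ->
    exists l, forall e, 0 < e -> exists N, forall n, (N <= n)%N ->
       abs (u n - l) < e.

Section AbsTheory.
Variables (R : realType) (F : fieldType) (abs : nonarch_abs R F).

Lemma nabs0 : abs 0 = 0.
Proof. exact/nabs_eq0. Qed.

Lemma nabs1 : abs 1 = 1.
Proof.
have n1 : abs 1 != 0.
  by apply/eqP => /nabs_eq0 /eqP; rewrite oner_eq0.
by apply: (mulfI n1); rewrite -nabsM !mulr1.
Qed.

Lemma nabsN x : abs (- x) = abs x.
Proof.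
have h : abs (-1) ^+ 2 = 1 by rewrite expr2 -nabsM mulrNN mulr1 nabs1.
have h1 : abs (-1) = 1.
  by apply/eqP; rewrite -(@eqrXn2 _ 2) ?nabs_ge0 ?h ?expr1n.
by rewrite -mulN1r nabsM h1 mul1r.
Qed.

Lemma nabsX x n : abs (x ^+ n) = abs x ^+ n.
Proof. by elim: n => [|n IH]; rewrite ?expr0 ?nabs1// !exprS nabsM IH. Qed.

Lemma nabsV x : abs x^-1 = (abs x)^-1.
Proof.
have [->|x0] := eqVneq x 0; first by rewrite invr0 nabs0 invr0.
have ax : abs x != 0 by apply/eqP => /nabs_eq0/eqP; rewrite (negbTE x0).
by apply: (mulfI ax); rewrite -nabsM !divff// nabs1.
Qed.

Lemma nabs_1sub x : abs x < 1 -> abs (1 - x) = 1.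
Proof.
move=> x1; apply/eqP; rewrite eq_le; apply/andP; split.
  apply: (le_trans (nabs_ultra _ _ _)).
  by rewrite nabsN nabs1 ge_max lexx ltW.
have := nabs_ultra abs (1 - x) x; rewrite subrK nabs1 le_max.
by case/orP => // h; have := le_lt_trans h x1; rewrite ltxx.
Qed.

End AbsTheory.

Section C0.
Variables (R : realType) (F : fieldType) (abs : nonarch_abs R F).
Variable (I : choiceType).

Definition vanishing (f : I -> F) : Prop :=
  forall c, 0 < c -> finite_set [set x | c <= abs (f x)].

Definition c0_pred : {pred I -> F^o} := fun f => `[< vanishing f >].

Lemma c0_submod : submod_closed c0_pred.
Proof.
split.
  apply/asboolP => c c0; apply: (@sub_finite_set _ _ set0) => // x /=.
  by rewrite nabs0 leNgt c0.
move=> a f g /asboolP vf /asboolP vg; apply/asboolP => c c0.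
have h : 0 < c / (abs a + 1) by rewrite divr_gt0// ltr_wpDl// nabs_ge0.
apply: (@sub_finite_set _ _
  ([set x | c / (abs a + 1) <= abs (f x)] `|` [set x | c <= abs (g x)])).
  move=> x /= /le_trans /(_ (nabs_ultra _ _ _)); rewrite le_max.
  case/orP; [left|by right].
  rewrite ler_pdivrMr; last by rewrite ltr_wpDl// nabs_ge0.
  apply: le_trans (_ : abs (a * f x) <= _); first by [].
  rewrite nabsM mulrDr mulr1 [X in _ <= X + _]mulrC lerDl.
  exact: nabs_ge0.
by rewrite finite_setU; split; [exact: vf|exact: vg].
Qed.

HB.instance Definition _ :=
  GRing.isSubmodClosed.Build F (I -> F^o) c0_pred c0_submod.

Record c0 := MkC0 { c0_fun :> I -> F^o; _ : c0_fun \in c0_pred }.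

HB.instance Definition _ := [isSub for c0_fun].
HB.instance Definition _ := [Choice of c0 by <:].
HB.instance Definition _ := [SubChoice_isSubLmodule of c0 by <:].

Definition c0_norm (v : c0) : R := sup (range (fun x => abs (v x))).

Lemma c0_delta_subproof (x : I) :
  (fun y => (y == x)%:R : F^o) \in c0_pred.
Proof.
apply/asboolP => c c0; apply: (@sub_finite_set _ _ [set x]) => // y /=.
by case: eqP => // _; rewrite nabs0 leNgt c0.
Qed.

Definition c0_delta (x : I) : c0 := MkC0 (c0_delta_subproof x).

End C0.

Section Normed.
Variables (R : realType) (F : fieldType) (abs : nonarch_abs R F).
Variables (V : lmodType F) (nrm : V -> R).

Definition continuous_op (T : V -> V) : Prop :=
  forall v e, 0 < e -> exists2 d, 0 < d &
    forall w, nrm (w - v) < d -> nrm (T w - T v) < e.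

Definition continuous_form (B : V -> V -> F) : Prop :=
  forall v w e, 0 < e -> exists2 d, 0 < d &
    forall v' w', nrm (v' - v) < d -> nrm (w' - w) < d ->
      abs (B v' w' - B v w) < e.

Record inner_product (B : V -> V -> F) : Prop := InnerProduct {
  ip_linearl : forall w, scalar (fun v => B v w);
  ip_linearr : forall v, scalar (B v);
  ip_symm : forall v w, B v w = B w v;
  ip_nondeg : forall v, (forall w, B v w = 0) -> v = 0;
  ip_continuous : continuous_form B }.

End Normed.

Record intpart := IntPart {
  parts :> seq nat;
  intpart_sorted : sorted geq parts;
  intpart_gt0 : all (fun p => 0 < p)%N parts }.

Section Tableaux.
Variable la : intpart.

(* Rows and columns are numbered from 0, which leaves the contents unchanged;
   labels are numbered from 1. *)
Definition in_diag (s : seq nat) (b : nat * nat) : bool :=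
  (b.2 < nth 0 s b.1)%N.

Definition n_min : nat := (sumn la + head 0 la)%N.

Definition diag_n (n : nat) : seq nat := (n - sumn la)%N :: la.

Definition in_diag_inf (b : nat * nat) : bool :=
  (b.1 == 0)%N || in_diag la (b.1.-1, b.2).

Lemma in_diag_infP b :
  reflect (exists2 n, (n_min <= n)%N & in_diag (diag_n n) b) (in_diag_inf b).
Proof.
case: b => [[|i] j]; rewrite /in_diag_inf /in_diag /=; apply: (iffP idP) => //.
- move=> _; exists (n_min + j.+1)%N; first exact: leq_addr.
  by rewrite /n_min; lia.
- by move=> h; exists n_min.
- by case.
Qed.

Definition box := {b : nat * nat | in_diag_inf b}.
Definition row (b : box) : nat := (val b).1.
Definition col (b : box) : nat := (val b).2.
Definition content (b : box) : int := (col b)%:Z - (row b)%:Z.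

Definition standard (f : box -> nat) : Prop :=
  [/\ set_bij [set: box] [set n | (0 < n)%N] f,
      forall b b', row b = row b' -> (col b < col b')%N -> (f b < f b')%N
    & forall b b', col b = col b' -> (row b < row b')%N -> (f b < f b')%N].

Record syt := SYT { filling :> box -> nat; _ : `[< standard filling >] }.

HB.instance Definition _ := [isSub for filling].
HB.instance Definition _ := [Choice of syt by <:].

Lemma sytP (tau : syt) : standard tau.
Proof. by case: tau => f /= /asboolP. Qed.

Definition corner : box := Sub (0, 0)%N isT.

(* For i >= 1 this is the unique box with label i. *)
Definition box_of (tau : syt) (i : nat) : box := xget corner [set b | tau b = i].

Lemma box_ofK (tau : syt) i : (0 < i)%N -> tau (box_of tau i) = i.
Proof.
move=> i0; rewrite /box_of; case: xgetP => [b _ ->//|h].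
have [[_ _ s] _ _] := sytP tau; have [b _ e] := s _ i0.
by case: (h b).
Qed.

Lemma filling_inj (tau : syt) : injective tau.
Proof.
have [[_ s _] _ _] := sytP tau.
by move=> b b' e; apply: s; rewrite ?inE.
Qed.

Lemma filling_gt0 (tau : syt) b : (0 < tau b)%N.
Proof. by have [[s _ _] _ _] := sytP tau; apply: s. Qed.

Lemma fillingK (tau : syt) b : box_of tau (tau b) = b.
Proof. by apply: (@filling_inj tau); rewrite box_ofK// filling_gt0. Qed.

Definition ctau (tau : syt) (i : nat) : int := content (box_of tau i).

Definition same_row (tau : syt) (i : nat) : bool :=
  row (box_of tau i) == row (box_of tau i.+1).
Definition same_col (tau : syt) (i : nat) : bool :=
  col (box_of tau i) == col (box_of tau i.+1).

Definition right_above (b b' : box) : bool :=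
  (col b' < col b)%N && (row b < row b')%N.

(* s_i(tau) > tau and s_i(tau) < tau, respectively. *)
Definition s_up (tau : syt) (i : nat) : bool :=
  right_above (box_of tau i.+1) (box_of tau i).
Definition s_down (tau : syt) (i : nat) : bool :=
  right_above (box_of tau i) (box_of tau i.+1).

Definition swap_nat (i n : nat) : nat :=
  if n == i then i.+1 else if n == i.+1 then i else n.

(* Swapping the labels i and i+1; by [s_act_standard] the default value tau is
   not used when i and i+1 are in different rows and columns of tau. *)
Definition s_act (i : nat) (tau : syt) : syt := insubd tau (swap_nat i \o tau).

Lemma swap_natK i : involutive (swap_nat i).
Proof. by move=> n; rewrite /swap_nat; do ![case: eqP => //=]; lia. Qed.

Lemma s_act_val i (tau : syt) : standard (swap_nat i \o tau) ->
  s_act i tau = swap_nat i \o tau :> (box -> nat).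
Proof. by move=> h; rewrite /s_act insubdK//; apply/asboolP. Qed.

Lemma s_actK i : involutive (s_act i).
Proof.
move=> tau; have [h|h] := pselect (standard (swap_nat i \o tau)); last first.
  have e : s_act i tau = tau by rewrite /s_act /insubd insubF//; exact: asboolF.
  by rewrite !e.
have e := s_act_val h.
have h' : swap_nat i \o s_act i tau = filling tau.
  by rewrite e; apply/funext => b /=; rewrite swap_natK.
apply: val_inj; rewrite [LHS]s_act_val ?h'//.
exact: sytP.
Qed.

Lemma s_act_standard i (tau : syt) : (0 < i)%N -> ~~ same_row tau i -> ~~ same_col tau i ->
  standard (swap_nat i \o tau).
Proof.
move=> i0 nr nc; have [[f1 f2 f3] rowP colP] := sytP tau.
have mono b b' : ~ (b = box_of tau i /\ b' = box_of tau i.+1) ->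
    (tau b < tau b')%N -> (swap_nat i (tau b) < swap_nat i (tau b'))%N.
  move=> nb lt; have nbb : ~ (tau b = i /\ tau b' = i.+1).
    by move=> [e e']; apply: nb; rewrite -[in box_of tau i.+1]e' -[in box_of tau i]e
      !fillingK.
  by rewrite /swap_nat; do ![case: eqP => //=]; lia.
split; first split.
- move=> b _ /=; have := filling_gt0 tau b.
  by rewrite /swap_nat; do ![case: eqP => //=]; lia.
- by move=> b b' _ _ /= /(can_inj (swap_natK i)) /filling_inj.
- move=> n /= n0; have s0 : (0 < swap_nat i n)%N.
    by rewrite /swap_nat; do ![case: eqP => //=]; lia.
  by exists (box_of tau (swap_nat i n)) => //=; rewrite box_ofK// swap_natK.
- move=> b b' e lt; apply: mono (rowP _ _ e lt) => -[eb eb'].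
  by move: nr; rewrite /same_row -eb -eb' e eqxx.
- move=> b b' e lt; apply: mono (colP _ _ e lt) => -[eb eb'].
  by move: nc; rewrite /same_col -eb -eb' e eqxx.
Qed.

Lemma s_act_up (tau : syt) i b : (0 < i)%N -> s_up tau i ->
  s_act i tau b = swap_nat i (tau b).
Proof.
move=> i0 /andP[c r]; rewrite s_act_val//.
by apply: s_act_standard => //; rewrite /same_row /same_col; apply/eqP; lia.
Qed.

Lemma s_act_down (tau : syt) i b : (0 < i)%N -> s_down tau i ->
  s_act i tau b = swap_nat i (tau b).
Proof.
move=> i0 /andP[c r]; rewrite s_act_val//.
by apply: s_act_standard => //; rewrite /same_row /same_col; apply/eqP; lia.
Qed.

(* Column j consists of its box in the infinite first row and of the boxes of
   the rows of la that are longer than j. *)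
Definition colheight (j : nat) : nat := (count (fun p => j < p)%N la).+1.

Definition colstart (j : nat) : nat := (\sum_(k < j) colheight k)%N.

Definition colfill (b : box) : nat := (colstart (col b) + row b).+1.

Lemma in_diag_infE b : in_diag_inf b = (b.1 < colheight b.2)%N.
Proof.
have geq_trans : transitive geq.
  by move=> b1 b2 b3 /= h1 h2; exact: leq_trans h2 h1.
have key (s : seq nat) i j : sorted geq s ->
    (j < nth 0 s i)%N = (i < count (fun p => j < p)%N s)%N.
  elim: s i => [|p s IH] [|i] //= ps.
    have [jp|pj] := ltnP j p; first by [].
    rewrite (@eq_in_count _ _ pred0) ?count_pred0// => q qs /=.
    have /allP/(_ q qs) /= := order_path_min geq_trans ps.
    by move=> h; apply/negbTE; rewrite -leqNgt (leq_trans h pj).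
  rewrite IH; last exact: path_sorted ps.
  have [jp|pj] := ltnP j p; first by [].
  rewrite (@eq_in_count _ _ pred0) ?count_pred0// => q qs /=.
  have /allP/(_ q qs) /= := order_path_min geq_trans ps.
  by move=> h; apply/negbTE; rewrite -leqNgt (leq_trans h pj).
case: b => [[|i] j]; rewrite /in_diag_inf /in_diag /colheight //=.
by rewrite key ?ltnS//; exact: intpart_sorted.
Qed.

Lemma colstartS j : colstart j.+1 = (colstart j + colheight j)%N.
Proof. by rewrite /colstart big_ord_recr. Qed.

Lemma colstart_homo i j : (i <= j)%N -> (colstart i <= colstart j)%N.
Proof.
elim: j => [|j IH]; first by rewrite leqn0 => /eqP->.
rewrite leq_eqVlt => /predU1P[->//|/IH h].
by rewrite colstartS (leq_trans h)// leq_addr.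
Qed.

Lemma colfill_lt b b' : (colfill b < colfill b')%N =
  (col b < col b')%N || (col b == col b') && (row b < row b')%N.
Proof.
have H (c c' : box) : (col c < col c')%N -> (colfill c < colfill c')%N.
  move=> lt; rewrite /colfill ltnS.
  have := colstart_homo lt; rewrite colstartS.
  have := valP c; rewrite in_diag_infE -/(row c) -/(col c); lia.
case: (ltngtP (col b) (col b')) => [/H->//|/H h|e] /=.
  by apply/negbTE; rewrite -leqNgt ltnW.
by rewrite /colfill e ltnS ltn_add2l.
Qed.

Lemma colfill_standard : standard colfill.
Proof.
split; last 2 first.
- by move=> b b' _ h; rewrite colfill_lt h.
- by move=> b b' e h; rewrite colfill_lt e eqxx h orbT.
split.
- by [].
- move=> b b' _ _ e.
  have := colfill_lt b b'; have := colfill_lt b' b.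
  rewrite e ltnn => /esym h1 /esym h2.
  have [ec er] : col b = col b' /\ row b = row b' by move: h1 h2; lia.
  by apply: val_inj; rewrite [LHS]surjective_pairing [RHS]surjective_pairing
    -/(row b) -/(col b) er ec.
- move=> [//|n] _.
  have [j jP] : exists j, (n < colstart j.+1)%N.
    exists n; elim: n => [|n IH]; first by rewrite colstartS /colheight addnS.
    by rewrite colstartS /colheight; lia.
  case: (ex_minnP (ex_intro (fun j => n < colstart j.+1)%N j jP)) => {j jP} j.
  move=> lt jmin; have le : (colstart j <= n)%N.
    case: j lt jmin => [|j] lt jmin; first by rewrite /colstart big_ord0.
    by rewrite leqNgt; apply/negP => /jmin; rewrite ltnn.
  have bP : in_diag_inf ((n - colstart j)%N, j).
    by rewrite in_diag_infE /=; move: lt; rewrite colstartS; lia.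
  exists (Sub _ bP) => //.
  by rewrite /colfill /row /col SubK /= subnKC.
Qed.

Definition colstd : syt :=
  SYT (introT (asboolP (standard colfill)) colfill_standard).

Lemma colstd_below (b b' : box) : col b = col b' -> row b = (row b').+1 ->
  colstd b = (colstd b').+1.
Proof. by rewrite /= /colfill => -> ->; rewrite addnS. Qed.

End Tableaux.

Section Hecke.
Variables (R : realType) (F : fieldType) (abs : nonarch_abs R F) (t : F).
Variable la : intpart.

Definition Shat := c0 abs (syt la).
HB.instance Definition _ := GRing.Lmodule.on Shat.

Definition e_ (tau : syt la) : Shat := c0_delta abs tau.

Definition Shat_norm (v : Shat) : R := c0_norm v.

Record hecke_op (i : nat) (T : Shat -> Shat) : Prop := HeckeOp {
  hecke_linear : linear T;
  hecke_continuous : continuous_op Shat_norm T;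
  hecke_row : forall tau, same_row tau i -> T (e_ tau) = e_ tau;
  hecke_col : forall tau, same_col tau i -> T (e_ tau) = - t *: e_ tau;
  hecke_up : forall tau, s_up tau i ->
    let d := ctau tau i.+1 - ctau tau i in
    T (e_ tau) = e_ (s_act i tau) + ((1 - t) / (1 - t ^ d)) *: e_ tau;
  hecke_down : forall tau, s_down tau i ->
    let d := ctau tau i - ctau tau i.+1 in
    T (e_ tau) =
      (t * ((1 - t ^ (d - 1)) * (1 - t ^ (d + 1)) / (1 - t ^ d) ^+ 2))
        *: e_ (s_act i tau)
      - (t ^ d * ((1 - t) / (1 - t ^ d))) *: e_ tau }.

Lemma c0_has_ubound (I : choiceType) (v : c0 abs I) :
  has_ubound (range (fun x => abs (v x))).
Proof.
have /asboolP/(_ 1 ltr01)/finite_seqP[s sE] := valP v.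
exists (\sum_(x <- s) abs (v x) + 1) => _ [x _ <-].
have [h|h] := leP 1 (abs (v x)); last first.
  by rewrite (le_trans (ltW h))// lerDr sumr_ge0// => *; exact: nabs_ge0.
have xs : x \in s by have : [set` s] x by rewrite -sE.
rewrite (big_rem x)//= -addrA lerDl addr_ge0// sumr_ge0// => *.
exact: nabs_ge0.
Qed.

Lemma c0_norm_ub (I : choiceType) (v : c0 abs I) x : abs (v x) <= c0_norm v.
Proof. by apply: ub_le_sup; [exact: c0_has_ubound|exists x]. Qed.

Let sw i (tau : syt la) : F := if same_row tau i then 1 else
  if same_col tau i then - t else
  if s_up tau i then (1 - t) / (1 - t ^ (ctau tau i.+1 - ctau tau i)) else
  if s_down tau i then let d := ctau tau i - ctau tau i.+1 in
    - (t ^ d * ((1 - t) / (1 - t ^ d)))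
  else 0.

Let so i (tau : syt la) : F :=
  if s_up tau i then 1 else
  if s_down tau i then let d := ctau tau i - ctau tau i.+1 in
    t * ((1 - t ^ (d - 1)) * (1 - t ^ (d + 1)) / (1 - t ^ d) ^+ 2)
  else 0.

Hypothesis t1 : abs t < 1.

Let abst (d : int) : 0 < d -> abs (t ^ d) < 1.
Proof.
case: d => // n; rewrite -exprnP nabsX => n0.
by rewrite exprn_ilt1// ?nabs_ge0//; move: n0; case: n.
Qed.

Let abs1t (d : int) : 0 < d -> abs (1 - t ^ d) = 1.
Proof. by move=> /abst /nabs_1sub. Qed.

Let up_gt0 (tau : syt la) i : s_up tau i -> 1 < ctau tau i.+1 - ctau tau i.
Proof. by rewrite /s_up /right_above /ctau /content => /andP[]; lia. Qed.

Let down_gt0 (tau : syt la) i : s_down tau i -> 1 < ctau tau i - ctau tau i.+1.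
Proof. by rewrite /s_down /right_above /ctau /content => /andP[]; lia. Qed.

Let sw_le1 i tau : abs (sw i tau) <= 1.
Proof.
rewrite /sw; case: ifP => _; first by rewrite nabs1.
case: ifP => _; first by rewrite nabsN ltW.
case: ifP => [/up_gt0 h|_].
  by rewrite nabsM nabsV (nabs_1sub t1) abs1t ?invr1 ?mulr1//; lia.
case: ifP => [/down_gt0 h|_]; last by rewrite nabs0.
rewrite /= nabsN !nabsM nabsV (nabs_1sub t1) abs1t; last by lia.
by rewrite invr1 !mulr1 ltW// abst//; lia.
Qed.

Let so_le1 i tau : abs (so i tau) <= 1.
Proof.
rewrite /so; case: ifP => _; first by rewrite nabs1.
case: ifP => [/down_gt0 h|_]; last by rewrite nabs0.
rewrite /= !nabsM nabsV nabsX !abs1t; [|lia..].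
by rewrite expr1n invr1 !mulr1 ltW.
Qed.

Let Tfun i (v : Shat) : syt la -> F^o := fun s =>
  sw i s * v s + so i (s_act i s) * v (s_act i s).

Let Tfun_le i v s : abs (Tfun i v s) <= Num.max (abs (v s)) (abs (v (s_act i s))).
Proof.
apply: le_trans (nabs_ultra _ _ _) _; rewrite !nabsM.
rewrite ge_max !le_max; apply/andP; split; apply/orP; [left|right];
  by apply: ler_piMl; rewrite ?nabs_ge0.
Qed.

Let Tfun_c0 i v : Tfun i v \in c0_pred abs (I := syt la).
Proof.
apply/asboolP => c cp; have /asboolP/(_ c cp) fv := valP v.
apply: (@sub_finite_set _ _ ([set x | c <= abs (v x)] `|`
  (s_act i @` [set x | c <= abs (v x)]))); last first.
  by rewrite finite_setU; split=> //; exact: finite_image.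
move=> s /= /le_trans /(_ (Tfun_le i v s)); rewrite le_max.
by case/orP; [left|right; exists (s_act i s) => //; exact: s_actK].
Qed.

Lemma hecke_op_exists i : (0 < i)%N -> exists T, hecke_op i T.
Proof.
move=> i0; pose T v : Shat := MkC0 (Tfun_c0 i v).
have Te tau : T (e_ tau) = sw i tau *: e_ tau + so i tau *: e_ (s_act i tau).
  apply/val_inj/funext => s.
  change (sw i s * (s == tau)%:R + so i (s_act i s) * (s_act i s == tau)%:R =
    sw i tau * (s == tau)%:R + so i tau * (s == s_act i tau)%:R).
  congr (_ + _); first by have [->|] := eqVneq s tau; rewrite ?mulr0.
  have -> : (s_act i s == tau) = (s == s_act i tau).
    by apply/eqP/eqP => [<-|->]; rewrite s_actK.
  by have [->|] := eqVneq s (s_act i tau); rewrite ?s_actK ?mulr0.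
have linT : linear T.
  move=> a v w; apply/val_inj/funext => s.
  change (sw i s * (a * v s + w s) +
      so i (s_act i s) * (a * v (s_act i s) + w (s_act i s)) =
    a * (sw i s * v s + so i (s_act i s) * v (s_act i s)) +
      (sw i s * w s + so i (s_act i s) * w (s_act i s))).
  by rewrite !mulrDr addrACA !(mulrCA a).
exists T; split => //.
- move=> v e e0; exists e => // w; apply: le_lt_trans.
  have -> : T w - T v = T (w - v).
    have -> : w - v = -1 *: v + w by rewrite scaleN1r addrC.
    by rewrite linT scaleN1r addrC.
  apply: ge_sup; first by exists (abs (T (w - v) (colstd la))), (colstd la).
  move=> _ [s _ <-]; apply: le_trans (Tfun_le i _ s) _.
  by rewrite ge_max !c0_norm_ub.
- move=> tau h; rewrite Te /sw /so h; move: h.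
  rewrite /same_row /s_up /s_down /right_above => /eqP ->.
  by rewrite ltnn !andbF scale1r scale0r addr0.
- move=> tau h; rewrite Te /sw /so h; move: h; rewrite /same_col => /eqP h.
  have -> : same_row tau i = false.
    apply/negbTE/negP => /eqP h'; have eb : box_of tau i = box_of tau i.+1.
      apply: val_inj; rewrite [LHS]surjective_pairing [RHS]surjective_pairing.
      by rewrite -/(row _) -/(col _) -/(row (box_of tau i.+1)) h h'.
    by have := box_ofK tau (ltn0Sn i); rewrite -eb box_ofK//; lia.
  by rewrite /s_up /s_down /right_above h ltnn /= scale0r addr0.
- move=> tau h d; rewrite Te /sw /so h.
  have [-> ->] : same_row tau i = false /\ same_col tau i = false.
    by move/andP: h; rewrite /same_row /same_col; lia.
  by rewrite scale1r addrC.
- move=> tau h d; rewrite Te /sw /so h.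
  have [-> -> ->] : [/\ same_row tau i = false, same_col tau i = false
      & s_up tau i = false].
    by move/andP: h; rewrite /same_row /same_col /s_up /right_above; split; lia.
  by rewrite /= scaleNr addrC.
Qed.

End Hecke.

(* Main.v *)
Require Import Defs.
From mathcomp Require Import all_boot all_order all_algebra.
From mathcomp Require Import boolp classical_sets cardinality fsbigop.
From mathcomp Require Import reals zify ring lra.

(** Existence comes from a diagonal form, uniqueness from the fact that the
    basis vectors [e_tau] are joint eigenvectors of self-adjoint operators.

    Uniqueness.  The Jucys-Murphy operators, defined by [Y_1 = id] and
    [Y_(i+1) = T_i Y_i T_i], are self-adjoint for any form for which the [T_i]
    are, and act on [e_tau] by [t ^ (i - 1 - c_tau(i))].  This is a computation
    on the planes spanned by [e_tau] and [e_(s_i tau)]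
    ([jucys_murphy_pair], [jucys_murphy_eigen]).  As [0 < |t| < 1], the powers
    of [t] are pairwise distinct, and a standard tableau is determined by the
    contents of its labels ([contents_inj]); hence distinct basis vectors are
    orthogonal.  If [s_i tau > tau], the self-adjointness of [T_i] on the plane
    of [e_tau] and [e_(s_i tau)] forces
      [(e_(s_i tau), e_(s_i tau)) = norm_ratio d * (e_tau, e_tau)],
    where [d] is the difference of the two contents.  Every tableau is reached
    from the column-standard one by finitely many such upward swaps
    ([syt_ind]): the tableau without descents is the column-standard one, and a
    swap at a descent removes exactly one inversion.  So the normalization
    determines the form on the basis, and by density of the finite
    combinations and continuity it determines the form.

    Existence.  The recursion for the squared norms has the closed solution
    [norm_weight tau], the product of [norm_ratio] over the inversions of
    [tau], a finite set since the second box of an inversion is one of the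
    finitely many boxes below the infinite row.  Each factor has absolute value
    [|t|], so the weights are nonzero and bounded by 1.  Completeness of the
    field makes [sum_tau norm_weight tau * v_tau * w_tau] converge, and this
    form is continuous by the ultrametric inequality and nondegenerate because
    it recovers the coordinates of [v].  Self-adjointness of [T_i] need only be
    checked on pairs of basis vectors. *)

(* Gives [row] and [col] their meaning for boxes back, which the ones for
   matrices hide. *)
Import Defs.

Set Implicit Arguments.
Unset Strict Implicit.
Unset Printing Implicit Defensive.

Import Order.TTheory GRing.Theory Num.Theory.
Local Open Scope classical_set_scope.
Local Open Scope ring_scope.

(** * Unordered sums of vanishing families *)

Section Sums.
Variables (R : realType) (F : fieldType) (abs : nonarch_abs R F).
Hypothesis abs_complete : complete_abs abs.
Variable (I : choiceType).
Implicit Types (f g : I -> F) (s : seq I).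

Lemma nabs_sum_le f s (P : pred I) M : 0 <= M ->
  (forall x, x \in s -> P x -> abs (f x) <= M) ->
  abs (\sum_(x <- s | P x) f x) <= M.
Proof.
move=> M0 fM; rewrite big_seq_cond; elim/big_rec: _ => [|x y /andP[xs Px] yM].
  by rewrite nabs0.
by apply: le_trans (nabs_ultra _ _ _) _; rewrite ge_max fM.
Qed.

(** The common terms cancel; the remaining ones are outside [s0], and by the
    ultrametric inequality their number does not matter. *)
Lemma nabsB_sum_le f s0 s s' M : 0 <= M -> uniq s -> uniq s' ->
  {subset s0 <= s} -> {subset s0 <= s'} ->
  (forall x, x \notin s0 -> abs (f x) <= M) ->
  abs (\sum_(x <- s) f x - \sum_(x <- s') f x) <= M.
Proof.
move=> M0 us us' sub sub' fM.
rewrite (bigID (mem s')) /= [in X in _ - X](bigID (mem s)) /=.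
have -> : \sum_(x <- s' | x \in s) f x = \sum_(x <- s | x \in s') f x.
  rewrite -[LHS]big_filter -[RHS]big_filter; apply: perm_big; apply: uniq_perm.
  - exact: filter_uniq.
  - exact: filter_uniq.
  - by move=> x; rewrite !mem_filter andbC.
rewrite opprD addrACA subrr add0r.
apply: le_trans (nabs_ultra _ _ _) _; rewrite nabsN ge_max.
by apply/andP; split; apply: nabs_sum_le => // x _ xs; apply: fM;
  apply: contra xs => /[dup]/sub h /sub'.
Qed.

(** Convergence along the finite subsets of the index type: [I] need not be
    countable and carries no order. *)
Definition has_csum f (l : F) : Prop :=
  forall e, 0 < e -> exists s0, forall s, uniq s -> {subset s0 <= s} ->
    abs (\sum_(x <- s) f x - l) < e.

(** The partial sums over the finite sets where [|f|] is at least [1/(n+1)]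
    form a Cauchy sequence. *)
Lemma has_csum_exists f : vanishing abs f -> exists l, has_csum f l.
Proof.
move=> vf.
have /choice[S SP] (n : nat) : exists s : seq I, uniq s /\
    forall x, (x \in s) = (n.+1%:R^-1 <= abs (f x)).
  have /finite_seqP[s sE] := vf _ (ltac:(by rewrite invr_gt0 ltr0n) : 0 < n.+1%:R^-1).
  exists (undup s); split; first exact: undup_uniq.
  move=> x; rewrite mem_undup; apply/idP/idP => h.
    by have : [set` s] x by []; rewrite -sE.
  by have : [set x | n.+1%:R^-1 <= abs (f x)] x by []; rewrite sE.
have Sout n x : x \notin S n -> abs (f x) <= n.+1%:R^-1.
  by rewrite (SP n).2 -ltNge => /ltW.
have small (e : R) : 0 < e -> exists n, n.+1%:R^-1 < e.
  move=> e0; have /Num.Theory.archi_boundP := ltW (ltac:(by rewrite invr_gt0) : 0 < e^-1).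
  set n := Num.bound _ => h; exists n.
  rewrite -[ltRHS]invrK ltf_pV2 ?posrE ?invr_gt0 ?ltr0n//.
  by apply: lt_trans h _; rewrite ltr_nat.
have S_mono m n : (n <= m)%N -> {subset S n <= S m}.
  move=> nm x; rewrite !(SP _).2; apply: le_trans.
  by rewrite lef_pV2 ?posrE ?ltr0n// ler_nat.
have [l lP] : exists l, forall e, 0 < e -> exists N, forall n, (N <= n)%N ->
    abs (\sum_(x <- S n) f x - l) < e.
  apply: abs_complete => e /small[N Ne]; exists N => m n Nm Nn.
  apply: le_lt_trans Ne; apply: (@nabsB_sum_le _ (S N)).
  - by rewrite invr_ge0.
  - by have [] := SP m.
  - by have [] := SP n.
  - exact: S_mono.
  - exact: S_mono.
  - exact: Sout.
exists l => e e0; have [N1 N1e] := small _ e0; have [N2 N2e] := lP _ e0.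
pose n := maxn N1 N2; exists (S n) => s us sub.
rewrite -(subrK (\sum_(x <- S n) f x) (\sum_(x <- s) _)) -addrA.
apply: le_lt_trans (nabs_ultra _ _ _) _.
rewrite gt_max N2e ?leq_maxr// andbT; apply: le_lt_trans N1e.
apply: (@nabsB_sum_le _ (S n)) => //.
- by rewrite invr_ge0.
- by have [] := SP n.
- move=> x /Sout /le_trans; apply.
  by rewrite lef_pV2 ?posrE ?ltr0n// ler_nat ltnS leq_maxl.
Qed.

Lemma nabs_small0 (x : F) : (forall e, 0 < e -> abs x < e) -> x = 0.
Proof.
move=> h; apply/(nabs_eq0 abs)/eqP; rewrite eq_le nabs_ge0 andbT leNgt.
by apply/negP => /h; rewrite ltxx.
Qed.

Lemma has_csum_unique f l l' : has_csum f l -> has_csum f l' -> l = l'.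
Proof.
move=> fl fl'; apply/eqP; rewrite -subr_eq0; apply/eqP.
apply: nabs_small0 => e e0.
have [s0 h] := fl _ e0; have [s1 h'] := fl' _ e0.
pose s := undup (s0 ++ s1).
have us : uniq s by exact: undup_uniq.
have {}h : abs (\sum_(x <- s) f x - l) < e.
  by apply: h us _ => x xs; rewrite mem_undup mem_cat xs.
have {}h' : abs (\sum_(x <- s) f x - l') < e.
  by apply: h' us _ => x xs; rewrite mem_undup mem_cat xs orbT.
have -> : l - l' = (\sum_(x <- s) f x - l') - (\sum_(x <- s) f x - l) by ring.
by apply: le_lt_trans (nabs_ultra _ _ _) _; rewrite nabsN gt_max h h'.
Qed.

Lemma has_csum_linear a f g l m : has_csum f l -> has_csum g m ->
  has_csum (fun x => a * f x + g x) (a * l + m).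
Proof.
move=> fl gm e e0.
have a1 : 0 < abs a + 1 by rewrite ltr_wpDl// nabs_ge0.
have [s0 h] := fl _ (divr_gt0 e0 a1); have [s1 h'] := gm _ e0.
exists (s0 ++ s1) => s us sub.
have {}h : abs (\sum_(x <- s) f x - l) < e / (abs a + 1).
  by apply: h us _ => x xs; apply: sub; rewrite mem_cat xs.
have {}h' : abs (\sum_(x <- s) g x - m) < e.
  by apply: h' us _ => x xs; apply: sub; rewrite mem_cat xs orbT.
have -> : \sum_(x <- s) (a * f x + g x) - (a * l + m) =
    a * (\sum_(x <- s) f x - l) + (\sum_(x <- s) g x - m).
  by rewrite big_split /= -mulr_sumr; ring.
apply: le_lt_trans (nabs_ultra _ _ _) _; rewrite gt_max h' andbT.
rewrite nabsM; apply: (@le_lt_trans _ _ ((abs a + 1) * abs (\sum_(x <- s) f x - l))).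
  by rewrite ler_wpM2r ?nabs_ge0// lerDl.
by rewrite mulrC -ltr_pdivlMr.
Qed.

Lemma has_csum_single f x : (forall y, y != x -> f y = 0) -> has_csum f (f x).
Proof.
move=> f0 e e0; exists [:: x] => s us sub.
by rewrite (bigD1_seq x) ?sub ?inE//= big1 ?addr0 ?subrr ?nabs0.
Qed.

Lemma has_csum_le f l M : 0 <= M -> (forall x, abs (f x) <= M) ->
  has_csum f l -> abs l <= M.
Proof.
move=> M0 fM fl; rewrite leNgt; apply/negP => Ml.
have [s h] := fl _ (le_lt_trans M0 Ml).
have {}h : abs (\sum_(x <- undup s) f x - l) < abs l.
  by apply: h (undup_uniq s) _ => x; rewrite mem_undup.
suff : abs l < abs l by rewrite ltxx.
have {1}-> : l = \sum_(x <- undup s) f x - (\sum_(x <- undup s) f x - l) by ring.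
apply: le_lt_trans (nabs_ultra _ _ _) _; rewrite nabsN gt_max h andbT.
by apply: le_lt_trans Ml; apply: nabs_sum_le.
Qed.

Definition csum f : F := xget 0 [set l | has_csum f l].

Lemma csumP f : vanishing abs f -> has_csum f (csum f).
Proof. by move=> vf; apply: (xgetPex 0); exact: has_csum_exists. Qed.

Lemma csumE f l : has_csum f l -> csum f = l.
Proof.
move=> fl; apply: (has_csum_unique _ fl).
by apply: (xgetPex 0); exists l.
Qed.

End Sums.

(** * Density of finite combinations and continuous forms on c0 *)

Section C0Norm.
Variables (R : realType) (F : fieldType) (abs : nonarch_abs R F).
Variable (I : choiceType).
Local Notation V := (c0 abs I).
Implicit Types (v w : V).

Lemma c0_norm_le v M : 0 <= M -> (forall x, abs (v x) <= M) -> c0_norm v <= M.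
Proof.
move=> M0 vM; have [[_ [x _ _]]|none] := pselect (range (fun x => abs (v x)) !=set0).
  by apply: ge_sup => [|_ [y _ <-]//]; exists (abs (v x)), x.
by rewrite /c0_norm sup_out// => -[].
Qed.

Lemma c0_norm_ge0 v : 0 <= c0_norm v.
Proof.
have [[_ [x _ _]]|none] := pselect (range (fun x => abs (v x)) !=set0).
  exact: le_trans (nabs_ge0 abs (v x)) (c0_norm_ub v x).
by rewrite /c0_norm sup_out// => -[].
Qed.

Lemma c0_norm0 : c0_norm (0 : V) = 0.
Proof.
apply/eqP; rewrite eq_le c0_norm_ge0 andbT; apply: c0_norm_le => // x.
by rewrite (nabs0 abs).
Qed.

(** Truncating [v] to the finitely many coordinates of absolute value at least
    [e / 2] changes it by at most [e / 2]. *)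
Lemma c0_dense v (e : R) : 0 < e -> exists s : seq I,
  c0_norm (\sum_(x <- s) (v x : F) *: c0_delta abs x - v) < e.
Proof.
move=> e0; have e2 : 0 < e / 2 by rewrite divr_gt0.
have /asboolP/(_ _ e2)/finite_seqP[s sE] := valP v.
exists (undup s); apply: (@le_lt_trans _ _ (e / 2)); last by lra.
apply: c0_norm_le => [|y]; first exact: ltW.
have ev (r : seq I) : (\sum_(x <- r) (v x : F) *: c0_delta abs x : V) y =
    \sum_(x <- r) v x * (y == x)%:R.
  elim: r => [|x r IH]; first by rewrite !big_nil.
  by rewrite !big_cons -IH.
change (abs ((\sum_(x <- undup s) (v x : F) *: c0_delta abs x : V) y - v y) <= e / 2).
rewrite ev; have [ys|ys] := boolP (y \in undup s).
  rewrite (bigD1_seq y) ?undup_uniq//= eqxx mulr1 big1 ?addr0 ?subrr ?nabs0 ?ltW//.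
  by move=> x xy; rewrite eq_sym (negbTE xy) mulr0.
rewrite big_seq big1 ?sub0r ?nabsN.
  rewrite leNgt; apply: contra ys => /ltW h.
  by have : [set x | e / 2 <= abs (v x)] y by []; rewrite sE mem_undup.
move=> x xs; have [yx|] := eqVneq y x; last by rewrite mulr0.
by rewrite -yx (negbTE ys) in xs.
Qed.

Definition continuous_fun (f : V -> F) : Prop :=
  forall v e, 0 < e -> exists2 d, 0 < d &
    forall w, c0_norm (w - v) < d -> abs (f w - f v) < e.

Lemma continuous_scalar_ext (f g : V -> F) : scalar f -> scalar g ->
  continuous_fun f -> continuous_fun g ->
  (forall x, f (c0_delta abs x) = g (c0_delta abs x)) -> f =1 g.
Proof.
move=> lf lg cf cg fg v; apply/eqP; rewrite -subr_eq0; apply/eqP.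
apply: (@nabs_small0 _ _ abs) => e e0.
have [d1 d10 h1] := cf v _ e0; have [d2 d20 h2] := cg v _ e0.
have [s] := @c0_dense v (Num.min d1 d2) (ltac:(by rewrite lt_min d10)).
rewrite lt_min => /andP[/h1 {}h1 /h2 {}h2].
have fgs : f (\sum_(x <- s) (v x : F) *: c0_delta abs x) =
    g (\sum_(x <- s) (v x : F) *: c0_delta abs x).
  elim: s {h1 h2} => [|x s IH]; last by rewrite !big_cons lf lg fg IH.
  rewrite !big_nil; have := lf 1 0 0; have := lg 1 0 0.
  rewrite !scale1r !addr0 !mul1r => /eqP; rewrite -subr_eq0 opprD addNKr oppr_eq0.
  move=> /eqP -> /eqP; rewrite -subr_eq0 opprD addNKr oppr_eq0.
  by move=> /eqP ->.
set u := \sum_(x <- s) _ in h1 h2 fgs.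
have -> : f v - g v = (g u - g v) - (f u - f v) by rewrite fgs; ring.
by apply: le_lt_trans (nabs_ultra _ _ _) _; rewrite nabsN gt_max h1 h2.
Qed.

(** Separate continuity suffices because the density argument is applied to one
    variable at a time. *)
Lemma bilinear_ext (B C : V -> V -> F) :
  (forall w, scalar (B ^~ w)) -> (forall v, scalar (B v)) ->
  (forall w, scalar (C ^~ w)) -> (forall v, scalar (C v)) ->
  (forall w, continuous_fun (B ^~ w)) -> (forall v, continuous_fun (B v)) ->
  (forall w, continuous_fun (C ^~ w)) -> (forall v, continuous_fun (C v)) ->
  (forall x y, B (c0_delta abs x) (c0_delta abs y) =
     C (c0_delta abs x) (c0_delta abs y)) -> B = C.
Proof.
move=> B1 B2 C1 C2 cB1 cB2 cC1 cC2 BC; apply/funext => v; apply/funext => w.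
apply: (continuous_scalar_ext (f := B ^~ w) (g := C ^~ w)) => // x.
by apply: (continuous_scalar_ext (f := B _) (g := C _)).
Qed.

Lemma continuous_form_l (B : V -> V -> F) w :
  continuous_form abs (@c0_norm R F abs I) B -> continuous_fun (B ^~ w).
Proof.
move=> cB v e e0; have [d d0 h] := cB v w e e0; exists d => // v' v'v.
by apply: h; rewrite // subrr c0_norm0.
Qed.

Lemma continuous_form_r (B : V -> V -> F) v :
  continuous_form abs (@c0_norm R F abs I) B -> continuous_fun (B v).
Proof.
move=> cB w e e0; have [d d0 h] := cB v w e e0; exists d => // w' w'w.
by apply: h; rewrite // subrr c0_norm0.
Qed.

Lemma continuous_fun_comp (f : V -> F) (T : V -> V) :
  continuous_fun f -> continuous_op (@c0_norm R F abs I) T ->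
  continuous_fun (f \o T).
Proof.
move=> cf cT v e e0; have [d d0 h] := cf (T v) e e0.
by have [d' d'0 h'] := cT v d d0; exists d' => // w /h' /h.
Qed.

End C0Norm.

(** * Diagonal forms *)

Section DiagonalForm.
Variables (R : realType) (F : fieldType) (abs : nonarch_abs R F).
Hypothesis abs_complete : complete_abs abs.
Variables (I : choiceType) (a : I -> F).
Hypothesis a_le1 : forall x, abs (a x) <= 1.
Hypothesis a_neq0 : forall x, a x != 0.
Local Notation V := (c0 abs I).
Implicit Types (v w : V).

Definition diag_form v w : F := csum abs (fun x => a x * (v x * w x)).

Let term_le v w x : abs (a x * (v x * w x)) <= abs (v x) * c0_norm w.
Proof.
rewrite !nabsM -[leRHS]mul1r ler_pM ?mulr_ge0 ?nabs_ge0//.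
by rewrite ler_wpM2l ?nabs_ge0 ?c0_norm_ub.
Qed.

Let term_vanishing v w : vanishing abs (fun x => a x * (v x * w x)).
Proof.
move=> c c0; have w1 : 0 < c0_norm w + 1 by rewrite ltr_wpDl ?c0_norm_ge0.
have /asboolP/(_ _ (divr_gt0 c0 w1)) := valP v.
apply: sub_finite_set => x /= /le_trans /(_ (term_le v w x)) h.
rewrite ler_pdivrMr//; apply: le_trans h _.
by rewrite ler_wpM2l ?nabs_ge0 ?lerDl.
Qed.

Lemma diag_form_sym v w : diag_form v w = diag_form w v.
Proof.
by congr csum; apply/funext => x; rewrite [w x * _]mulrC.
Qed.

Lemma diag_form_linearr v : scalar (diag_form v).
Proof.
move=> c u w; apply: csumE.
rewrite (_ : (fun x => _) =
    fun x => c * (a x * (v x * u x)) + a x * (v x * w x)).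
  exact: has_csum_linear (csumP abs_complete (term_vanishing v u))
    (csumP abs_complete (term_vanishing v w)).
apply/funext => x.
by rewrite -[(c *: u + w) x]/(c * u x + w x); ring.
Qed.

Lemma diag_form_linearl w : scalar (diag_form ^~ w).
Proof. by move=> c u v; rewrite !(diag_form_sym _ w) diag_form_linearr. Qed.

Lemma diag_form_delta v x : diag_form v (c0_delta abs x) = a x * v x.
Proof.
rewrite /diag_form; apply: csumE.
have := @has_csum_single _ _ abs _ (fun y => a y * (v y * c0_delta abs x y)) x.
rewrite /= eqxx !mulr1; apply => y /negbTE ->.
by rewrite !mulr0.
Qed.

Lemma diag_form_le v w : abs (diag_form v w) <= c0_norm v * c0_norm w.
Proof.
apply: has_csum_le (csumP abs_complete (term_vanishing v w)).
  by rewrite mulr_ge0 ?c0_norm_ge0.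
move=> x; apply: le_trans (term_le v w x) _.
by rewrite ler_wpM2r ?c0_norm_ge0 ?c0_norm_ub.
Qed.

Lemma diag_form_continuous : continuous_form abs (@c0_norm R F abs I) diag_form.
Proof.
move=> v w e e0.
have K0 : 0 < c0_norm v + c0_norm w + 1.
  by rewrite ltr_wpDl ?addr_ge0 ?c0_norm_ge0.
exists (Num.min 1 (e / (c0_norm v + c0_norm w + 1))).
  by rewrite lt_min ltr01 divr_gt0.
move=> v' w'; rewrite !lt_min !ltr_pdivlMr// => /andP[v1 ve] /andP[w1 we].
have -> : diag_form v' w' - diag_form v w =
    diag_form (v' - v) (w' - w) + (diag_form (v' - v) w + diag_form v (w' - w)).
  have e1 z : diag_form (v' - v) z = diag_form v' z - diag_form v z.
    by rewrite (addrC v') -(scaleN1r v) [LHS](diag_form_linearl z) mulN1r addrC.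
  have e2 u : diag_form u (w' - w) = diag_form u w' - diag_form u w.
    by rewrite (addrC w') -(scaleN1r w) [LHS](diag_form_linearr u) mulN1r addrC.
  by rewrite !e1 !e2; ring.
have nv := c0_norm_ge0 v; have nw := c0_norm_ge0 w.
have nv' := c0_norm_ge0 (v' - v); have nw' := c0_norm_ge0 (w' - w).
(* The difference of the two values is split into three terms, each of which is
   bounded by the product of a small norm z and a norm x that is at most
   |v| + |w| + 1. *)
have cross (x y z : R) : 0 <= x -> 0 <= z ->
    x <= c0_norm v + c0_norm w + 1 -> z * (c0_norm v + c0_norm w + 1) < e ->
    y <= z * x -> y < e.
  by move=> x0 z0 xK zK /le_lt_trans; apply; apply: le_lt_trans zK; rewrite ler_wpM2l.
have le1 (x : R) : x <= 1 -> x <= c0_norm v + c0_norm w + 1.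
  by move=> x1; rewrite (le_trans x1)// lerDr addr_ge0.
have lew : c0_norm w <= c0_norm v + c0_norm w + 1 by rewrite -addrA addrCA lerDl addr_ge0.
have lev : c0_norm v <= c0_norm v + c0_norm w + 1 by rewrite -addrA lerDl addr_ge0.
apply: le_lt_trans (nabs_ultra _ _ _) _; rewrite gt_max; apply/andP; split.
  by apply: cross (le1 _ (ltW w1)) ve (diag_form_le _ _).
apply: le_lt_trans (nabs_ultra _ _ _) _; rewrite gt_max; apply/andP; split.
  by apply: cross lew ve (diag_form_le _ _).
by apply: cross lev we _ => //; rewrite mulrC diag_form_le.
Qed.

Lemma diag_form_inner_product :
  inner_product abs (@c0_norm R F abs I) diag_form.
Proof.
split.
- exact: diag_form_linearl.
- exact: diag_form_linearr.
- exact: diag_form_sym.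
- move=> v v0; apply/val_inj/funext => x.
  have := v0 (c0_delta abs x); rewrite diag_form_delta => /eqP.
  by rewrite mulf_eq0 (negbTE (a_neq0 x)) => /eqP.
- exact: diag_form_continuous.
Qed.

End DiagonalForm.

(** * Combinatorics of infinite standard tableaux *)

Lemma swap_natl i : swap_nat i i = i.+1.
Proof. by rewrite /swap_nat eqxx. Qed.

Lemma swap_natr i : swap_nat i i.+1 = i.
Proof. by rewrite /swap_nat gtn_eqF// eqxx. Qed.

Section TableauxTheory.
Variable la : intpart.
Implicit Types (tau sigma : syt la) (b : box la).

Lemma box_eq b b' : row b = row b' -> col b = col b' -> b = b'.
Proof.
move=> r c; apply: val_inj.
by rewrite [LHS]surjective_pairing [RHS]surjective_pairing -/(row b) -/(col b) r c.
Qed.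

Lemma in_diag_inf_le b r c : (r <= row b)%N -> (c <= col b)%N -> in_diag_inf la (r, c).
Proof.
move=> rb cb; have := valP b; rewrite !in_diag_infE /= -/(row b) -/(col b) => h.
apply: leq_ltn_trans rb (leq_trans h _); rewrite ltnS; apply: sub_count => p /=.
exact: leq_ltn_trans.
Qed.

(** The corner [(row b, col b')] of the rectangle lies in the diagram, so one
    can go from [b] to [b'] along a row and then down a column. *)
Lemma syt_lt tau b b' : (row b <= row b')%N -> (col b <= col b')%N -> b <> b' ->
  (tau b < tau b')%N.
Proof.
move=> r c nb; have [_ rowP colP] := sytP tau.
pose m : box la := Sub (row b, col b') (in_diag_inf_le r (leqnn (col b'))).
have mr : row m = row b by [].
have mc : col m = col b' by [].
have bm : b = m \/ (tau b < tau m)%N.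
  have := c; rewrite leq_eqVlt => /predU1P[e|lt]; last by right; apply: rowP.
  by left; apply: box_eq.
have mb' : m = b' \/ (tau m < tau b')%N.
  have := r; rewrite leq_eqVlt => /predU1P[e|lt]; last by right; apply: colP.
  by left; apply: box_eq.
case: bm mb' => [<-|lt] [e|lt'] //; first by rewrite -e.
exact: ltn_trans lt'.
Qed.

(** The formulas for [T_i] cover all cases: consecutive labels in one row or
    column are neighbours, which gives the value of the content, and [i+1]
    cannot lie strictly below and to the right of [i], since a third box of
    the rectangle between them would need a label between [i] and [i+1]. *)
Variant adjacent_spec tau i : Prop :=
  | AdjacentRow of same_row tau i & ctau tau i.+1 = ctau tau i + 1
  | AdjacentCol of same_col tau i & ctau tau i.+1 = ctau tau i - 1
  | AdjacentUp of s_up tau i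
  | AdjacentDown of s_down tau i.

Lemma adjacentP tau i : (0 < i)%N -> adjacent_spec tau i.
Proof.
move=> i0; set b := box_of tau i; set b' := box_of tau i.+1.
have tb : tau b = i by exact: box_ofK.
have tb' : tau b' = i.+1 by exact: box_ofK.
have nb'b : ~ ((row b' <= row b)%N && (col b' <= col b)%N).
  move=> /andP[r c]; have : (tau b' < tau b)%N.
    by apply: syt_lt => // e; move: tb'; rewrite e tb; lia.
  by rewrite tb tb'; lia.
(* A third box in the rectangle spanned by b and b' would need a label
   strictly between i and i+1. *)
have mid r c : (row b <= r <= row b')%N -> (col b <= c <= col b')%N ->
    (r, c) = (row b, col b) \/ (r, c) = (row b', col b').
  move=> /andP[r1 r2] /andP[c1 c2].
  pose m : box la := Sub (r, c) (in_diag_inf_le r2 c2).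
  have [e|mb] := pselect (m = b); first by left; rewrite -e.
  have [e|mb'] := pselect (m = b'); first by right; rewrite -e.
  have h1 : (tau b < tau m)%N by apply: syt_lt => // e; apply: mb.
  have h2 : (tau m < tau b')%N by apply: syt_lt.
  by exfalso; move: h1 h2; rewrite tb tb'; lia.
have [er|nr] := eqVneq (row b) (row b').
  apply: AdjacentRow; first by rewrite /same_row -/b -/b' er.
  have := mid (row b) (col b).+1; rewrite /ctau /content -/b -/b' -er.
  move=> /(_ _ _)[]; [lia|lia|by case; lia|by case; lia].
have [ec|nc] := eqVneq (col b) (col b').
  apply: AdjacentCol; first by rewrite /same_col -/b -/b' ec.
  have := mid (row b).+1 (col b); rewrite /ctau /content -/b -/b' -ec.
  move=> /(_ _ _)[]; [lia|lia|by case; lia|by case; lia].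
have [lr|lr] := leqP (row b) (row b'); last first.
  by apply: AdjacentUp; rewrite /s_up /right_above -/b -/b'; lia.
have [lc|lc] := leqP (col b) (col b'); last first.
  by apply: AdjacentDown; rewrite /s_down /right_above -/b -/b'; lia.
have := mid (row b) (col b'); move=> /(_ _ _)[]; [lia|lia|by case; lia|by case; lia].
Qed.

(** Induction on the label: two boxes of the same content are comparable
    on their diagonal.  If they both carried the label [i], one in each tableau,
    the smaller box would have a label below [i] in one tableau and equal to
    [i] in the other, against the induction hypothesis. *)
Lemma contents_inj tau sigma : (forall i, (0 < i)%N -> ctau tau i = ctau sigma i) ->
  tau = sigma.
Proof.
move=> h; suff H i : (0 < i)%N -> box_of tau i = box_of sigma i.
  apply/val_inj/funext => b; have t0 := filling_gt0 tau b.
  by rewrite /= -{2}(fillingK tau b) H// box_ofK.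
elim/ltn_ind: i => i IH i0.
have main (t1 t2 : syt la) : (forall i, (0 < i)%N -> ctau t1 i = ctau t2 i) ->
    (forall j, (j < i)%N -> (0 < j)%N -> box_of t1 j = box_of t2 j) ->
    ~ (row (box_of t1 i) < row (box_of t2 i))%N.
  move=> h12 IH12 lt; have := h12 i i0; rewrite /ctau /content => e.
  set b := box_of t1 i in lt e; set b' := box_of t2 i in lt e.
  have t2b : (t2 b < i)%N.
    rewrite -[X in (_ < X)%N](box_ofK t2 i0) -/b'.
    by apply: syt_lt; [lia|lia|move=> eb; move: lt; rewrite eb ltnn].
  have := IH12 _ t2b (filling_gt0 t2 b); rewrite fillingK => eb.
  have := box_ofK t1 (filling_gt0 t2 b); rewrite eb box_ofK//.
  by move=> ei; move: t2b; rewrite -ei ltnn.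
have h' j : (0 < j)%N -> ctau sigma j = ctau tau j by move=> /h.
have := main _ _ h IH; have := main _ _ h' (fun j ji j0 => esym (IH j ji j0)).
have := h i i0; rewrite /ctau /content => e n1 n2.
by apply: box_eq; lia.
Qed.

Section Swap.
Variables (tau : syt la) (i : nat).
Hypothesis i_gt0 : (0 < i)%N.

Lemma box_of_swap j : (0 < j)%N -> s_up tau i || s_down tau i ->
  box_of (s_act i tau) j = box_of tau (swap_nat i j).
Proof.
move=> j0 ud; have j'0 : (0 < swap_nat i j)%N.
  by rewrite /swap_nat; do ![case: eqP => //=]; lia.
apply: (@filling_inj _ (s_act i tau)); rewrite box_ofK//.
by case/orP: ud => h; rewrite ?(s_act_up _ i_gt0 h) ?(s_act_down _ i_gt0 h)
  box_ofK// swap_natK.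
Qed.

Lemma box_of_swapl : s_up tau i -> box_of (s_act i tau) i = box_of tau i.+1.
Proof. by move=> up; rewrite box_of_swap ?up// swap_natl. Qed.

Lemma box_of_swapr : s_up tau i -> box_of (s_act i tau) i.+1 = box_of tau i.
Proof. by move=> up; rewrite box_of_swap ?up// swap_natr. Qed.

Lemma s_down_swap : s_up tau i -> s_down (s_act i tau) i.
Proof. by move=> up; rewrite /s_down box_of_swapl// box_of_swapr. Qed.

Lemma s_up_swap : s_down tau i -> s_up (s_act i tau) i.
Proof. by move=> dn; rewrite /s_up !box_of_swap ?dn ?orbT// swap_natl swap_natr. Qed.

End Swap.

Lemma up_gt1 tau i : s_up tau i -> 1 < ctau tau i.+1 - ctau tau i.
Proof. by rewrite /s_up /right_above /ctau /content => /andP[]; lia. Qed.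

Lemma s_up_neq tau i : (0 < i)%N -> s_up tau i -> s_act i tau != tau.
Proof.
move=> i0 up; apply/eqP => E; have := s_down_swap i0 up; rewrite E.
by move: up; rewrite /s_up /s_down /right_above; lia.
Qed.

(** Without descents the column index weakly increases with the label, so the
    labels follow the columns from left to right. *)
Lemma no_descent_colstd tau :
  (forall i, (0 < i)%N -> ~~ s_down tau i) -> tau = colstd la.
Proof.
move=> nd.
have col_mono i j : (0 < i)%N -> (i <= j)%N ->
    (col (box_of tau i) <= col (box_of tau j))%N.
  move=> i0; elim: j => [|j IH]; first by lia.
  rewrite leq_eqVlt => /predU1P[->//|]; rewrite ltnS => ij.
  apply: leq_trans (IH ij) _; have j0 : (0 < j)%N by lia.
  have [r e|/eqP->//|/andP[/ltnW]//|d] := adjacentP tau j0.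
    by move: r e; rewrite /same_row /ctau /content; lia.
  by have := nd _ j0; rewrite d.
have mono b b' : (colfill b < colfill b')%N -> (tau b < tau b')%N.
  rewrite colfill_lt => /orP[lt|/andP[/eqP ec lr]].
    rewrite ltnNge; apply/negP => /(col_mono _ _ (filling_gt0 tau b')).
    by rewrite !fillingK; lia.
  by apply: syt_lt => //; [lia|lia|move=> e; move: lr; rewrite e ltnn].
(* A strictly increasing map of the positive integers dominates the identity;
   it is applied to the change of labels from tau to colstd and to its
   inverse. *)
have ge_id (f : nat -> nat) : (forall m n, (0 < m)%N -> (m < n)%N -> (f m < f n)%N) ->
    (forall m, (0 < m)%N -> (0 < f m)%N) -> forall m, (0 < m)%N -> (m <= f m)%N.
  move=> fm f0; elim=> [//|[_ _|m IH _]]; first exact: f0.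
  by apply: leq_ltn_trans (IH _) (fm _ _ _ _).
pose C := colstd la.
have mono' m n : (0 < m)%N -> (m < n)%N ->
    (C (box_of tau m) < C (box_of tau n))%N.
  move=> m0 mn; rewrite ltnNge leq_eqVlt; apply/negP => /predU1P[e|/mono].
    have n0 : (0 < n)%N by lia.
    by have := filling_inj e => /(congr1 tau); rewrite !box_ofK//; lia.
  by rewrite !box_ofK//; lia.
apply/val_inj/funext => b; apply/eqP; rewrite eqn_leq; apply/andP; split.
  have := ge_id (fun n => C (box_of tau n)) mono' (fun _ _ => filling_gt0 _ _)
    _ (filling_gt0 tau b).
  by rewrite fillingK.
have := ge_id (fun n => tau (box_of C n)) _ (fun _ _ => filling_gt0 _ _)
    _ (filling_gt0 C b).
rewrite fillingK; apply => m n m0 mn; apply: mono.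
change (C (box_of C m) < C (box_of C n))%N.
by rewrite !box_ofK//; lia.
Qed.

(** Pairs of boxes that are labeled in the order opposite to the one in the
    column-standard tableau. *)
Definition inversions tau : set (box la * box la) :=
  [set p | right_above p.1 p.2 /\ (tau p.1 < tau p.2)%N].

Lemma finite_lower : finite_set [set b : box la | (0 < row b)%N].
Proof.
pose C := colstd la; pose N := colstart la (sumn la).
apply: (@sub_finite_set _ _ (box_of C @` `I_N.+1)); last first.
  exact/finite_image/finite_II.
move=> b /= b0; exists (C b); last exact: fillingK.
have := valP b; rewrite in_diag_infE -/(row b) -/(col b) /= => rb.
have /hasP[p pla cp] : has (fun p => col b < p)%N la.
  by rewrite has_count; move: rb; rewrite /colheight; lia.
have ple : (p <= sumn la)%N by rewrite sumnE (big_rem p)//= leq_addr.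
have := colstart_homo la (leq_trans cp ple); rewrite colstartS /= /colfill /N.
by lia.
Qed.

(** The second box of an inversion is below the infinite first row, which leaves
    finitely many choices; the label of the first box is smaller than its
    label. *)
Lemma finite_inversions tau : finite_set (inversions tau).
Proof.
have fA b : finite_set [set b' : box la | (tau b' < tau b)%N].
  apply: (@sub_finite_set _ _ (box_of tau @` `I_(tau b))); last first.
    exact/finite_image/finite_II.
  by move=> b' /= h; exists (tau b') => //; exact: fillingK.
apply: sub_finite_set (finite_setXL (fun b _ => fA b) finite_lower) => -[b b'] /=.
by move=> [/andP[_ r] lt]; split=> //=; apply: leq_ltn_trans r.
Qed.

Lemma inversions_swap tau i : (0 < i)%N -> s_up tau i ->
  inversions (s_act i tau) =
  (box_of tau i.+1, box_of tau i) |` inversions tau.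
Proof.
move=> i0 up; have bi := box_ofK tau i0; have bi1 := box_ofK tau (ltn0Sn i).
apply/seteqP; split => -[b b'] /=.
  move=> [ra]; rewrite !s_act_up//= => lt.
  have [e|ne] := pselect (tau b = i.+1 /\ tau b' = i).
    by left; rewrite -e.1 -e.2 !fillingK.
  right; split=> //; move: lt ne; rewrite /swap_nat.
  by do ![case: eqP => //=]; lia.
move=> [[-> ->]|[/= ra lt]].
  by split=> //=; rewrite !s_act_up// bi bi1 swap_natl swap_natr.
split=> //=; rewrite !s_act_up//.
have ne : ~ (tau b = i /\ tau b' = i.+1).
  move=> [e e']; move: up; rewrite /s_up -e' -e !fillingK.
  by move: ra; rewrite /right_above; lia.
by move: lt ne; rewrite /swap_nat; do ![case: eqP => //=]; lia.
Qed.

(** Stated for any commutative monoid so as to serve both for the number of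
    inversions and for products over inversions. *)
Lemma big_inversions_swap (M : Type) (idx : M) (op : Monoid.com_law idx)
    (g : box la * box la -> M) (tau : syt la) i : (0 < i)%N -> s_up tau i ->
  \big[op/idx]_(p \in inversions (s_act i tau)) g p =
  op (g (box_of tau i.+1, box_of tau i)) (\big[op/idx]_(p \in inversions tau) g p).
Proof.
move=> i0 up; rewrite (fsbigD1 (box_of tau i.+1, box_of tau i)); last 2 first.
- exact: finite_inversions.
- by rewrite inversions_swap//; left.
congr (op _ _); apply: eq_fsbigl; rewrite inversions_swap//.
apply/seteqP; split => p /=; first by move=> [[->|]].
move=> pi; split; first by right.
move=> pe; move: pi; rewrite pe => -[_ /=].
by rewrite !box_ofK//; lia.
Qed.

Lemma inversions_colstd : inversions (colstd la) = set0.
Proof.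
rewrite -subset0 => -[b b'] [/andP[/= c _]] /=.
by rewrite colfill_lt; lia.
Qed.

(** Induction on the number of inversions: a tableau other than the
    column-standard one has a descent, and undoing it removes one
    inversion. *)
Lemma syt_ind (P : syt la -> Prop) : P (colstd la) ->
  (forall tau i, (0 < i)%N -> s_up tau i -> P tau -> P (s_act i tau)) ->
  forall tau, P tau.
Proof.
move=> P0 PS tau.
have [n] := ubnP (\big[addn/0%N]_(p \in inversions tau) 1%N).
elim: n tau => // n IH tau; rewrite ltnS => le_n.
have [->//|ne] := pselect (tau = colstd la).
have [i i0 dn] : exists2 i, (0 < i)%N & s_down tau i.
  apply: contrapT => none; apply/ne/no_descent_colstd => i i0.
  by apply/negP => dn; apply: none; exists i.
have up := s_up_swap i0 dn.
rewrite -(s_actK i tau); apply: PS => //; apply: IH.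
apply: leq_trans le_n; rewrite -[in leqRHS](s_actK i tau).
by rewrite (big_inversions_swap _ _ i0 up).
Qed.

End TableauxTheory.

(** * Powers of t and the squared norms of the basis vectors *)

Section PowersOfT.
Variables (R : realType) (F : fieldType) (abs : nonarch_abs R F) (t : F).
Hypothesis t_lt1 : abs t < 1.

Lemma nabs_expt_lt1 (d : int) : 0 < d -> abs (t ^ d) < 1.
Proof.
case: d => // n; rewrite -exprnP nabsX => n0.
by rewrite exprn_ilt1// ?nabs_ge0//; move: n0; case: n.
Qed.

Lemma nabs_1subt (d : int) : 0 < d -> abs (1 - t ^ d) = 1.
Proof. by move=> /nabs_expt_lt1 /nabs_1sub. Qed.

Lemma subr1t_neq0 (d : int) : 0 < d -> 1 - t ^ d != 0.
Proof.
by move=> /nabs_1subt h; apply/eqP => e; move/eqP: h; rewrite e nabs0 eq_sym oner_eq0.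
Qed.

(** The coefficient of [e_(s_i tau)] in [T_i e_tau] for a downward swap with
    content difference [d], which is the factor by which the squared norm of a
    basis vector changes under an upward swap. *)
Definition norm_ratio (d : int) : F :=
  t * ((1 - t ^ (d - 1)) * (1 - t ^ (d + 1)) / (1 - t ^ d) ^+ 2).

Lemma nabs_norm_ratio (d : int) : 1 < d -> abs (norm_ratio d) = abs t.
Proof.
move=> d1; rewrite !nabsM nabsV nabsX !nabs_1subt; [|lia..].
by rewrite expr1n invr1 !mulr1.
Qed.

Hypothesis t_gt0 : 0 < abs t.

Lemma t_neq0 : t != 0.
Proof. by apply/eqP => t0; move: t_gt0; rewrite t0 nabs0 ltxx. Qed.

Lemma expt_inj : injective (fun d : int => t ^ d).
Proof.
suff H (a b : int) : a < b -> t ^ a != t ^ b.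
  move=> a b e; have [/H|/H|//] := ltgtP a b; by rewrite e eqxx.
move=> ab; have ba : 0 < b - a by rewrite subr_gt0.
rewrite -subr_eq0 -(subrK a b) [b - a + a]addrC expfzDr ?t_neq0//.
rewrite -[X in X - _]mulr1 -mulrBr mulf_neq0 ?expfz_neq0 ?t_neq0//.
exact: subr1t_neq0.
Qed.

End PowersOfT.

Section NormWeight.
Variables (R : realType) (F : fieldType) (abs : nonarch_abs R F) (t : F).
Hypothesis t_lt1 : abs t < 1.
Variable la : intpart.
Implicit Types (tau : syt la).

(** The squared norm of [e_tau]: one factor for each upward swap on any way
    from the column-standard tableau to [tau], hence one for each inversion. *)
Definition norm_weight tau : F :=
  \big[*%R/1]_(p \in inversions tau) norm_ratio t (content p.1 - content p.2).

Lemma norm_weight_colstd : norm_weight (colstd la) = 1.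
Proof. by rewrite /norm_weight inversions_colstd fsbig_set0. Qed.

Lemma norm_weight_swap tau i : (0 < i)%N -> s_up tau i ->
  norm_weight (s_act i tau) =
  norm_ratio t (ctau tau i.+1 - ctau tau i) * norm_weight tau.
Proof. by move=> i0 up; rewrite /norm_weight big_inversions_swap. Qed.

Lemma norm_weight_le1 tau : abs (norm_weight tau) <= 1.
Proof.
elim/syt_ind: tau => [|tau i i0 up IH]; first by rewrite norm_weight_colstd nabs1.
rewrite norm_weight_swap// nabsM (nabs_norm_ratio t_lt1 (up_gt1 up)).
by rewrite mulr_ile1 ?nabs_ge0// ltW.
Qed.

Hypothesis t_gt0 : 0 < abs t.

Lemma norm_weight_neq0 tau : norm_weight tau != 0.
Proof.
elim/syt_ind: tau => [|tau i i0 up IH]; first by rewrite norm_weight_colstd oner_eq0.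
rewrite norm_weight_swap// mulf_neq0//; apply/eqP => z.
by have := t_gt0; rewrite -(nabs_norm_ratio t_lt1 (up_gt1 up)) z nabs0 ltxx.
Qed.

End NormWeight.

(** * Jucys-Murphy operators *)

Lemma scale_of_linear (F : fieldType) (V W : lmodType F) (f : V -> W) a u :
  linear f -> f (a *: u) = a *: f u.
Proof.
move=> lf; have f0 : f 0 = 0.
  by have := lf (-1) 0 0; rewrite !scaleN1r oppr0 addr0 addNr.
by rewrite -[a *: u]addr0 lf f0 addr0.
Qed.

Lemma scale_of_scalar (F : fieldType) (V : lmodType F) (f : V -> F) a u :
  scalar f -> f (a *: u) = a * f u.
Proof. exact: (@scale_of_linear F V F^o f). Qed.

(** One step of the eigenvalue computation.  In the plane of [e = e_tau] and
    [e' = e_(s_i tau)], for an upward swap with [q = t ^ d], the operator [T]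
    has the matrix with entries [alpha], [1], [beta], [- q alpha].  The
    off-diagonal entries of [T X T] cancel because the eigenvalues of [X] have
    ratio [q], and the diagonal ones simplify through
    [(t - q) (1 - q t) + (1 - t)^2 q = t (1 - q)^2]. *)
Lemma jucys_murphy_pair (F : fieldType) (V : lmodType F) (T X : V -> V)
    (e e' : V) (t q y : F) :
  linear T -> linear X -> t != 0 -> 1 - q != 0 ->
  let alpha := (1 - t) / (1 - q) in
  let beta := t * ((1 - q / t) * (1 - q * t) / (1 - q) ^+ 2) in
  T e = e' + alpha *: e -> T e' = beta *: e - (q * alpha) *: e' ->
  X e = (q * y) *: e -> X e' = y *: e' ->
  T (X (T e)) = (t * y) *: e /\ T (X (T e')) = (t * (q * y)) *: e'.
Proof.
move=> lT lX t0 q1 al be Te Te' Xe Xe'.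
have lin (f : V -> V) : linear f -> forall a b u v,
    f (a *: u + b *: v) = a *: f u + b *: f v.
  by move=> lf a b u v; rewrite lf (scale_of_linear _ _ lf).
have {}Te : T e = 1 *: e' + al *: e by rewrite scale1r.
have {}Te' : T e' = be *: e + (- (q * al)) *: e' by rewrite scaleNr.
split.
  rewrite Te lin// Xe Xe' !scalerA lin// Te Te' !scalerDr !scalerA.
  rewrite [X in _ + X]addrC addrACA -!scalerDl.
  rewrite (_ : _ + _ * 1 = 0) ?scale0r ?addr0; last by ring.
  by congr (_ *: _); rewrite /al /be; field; apply/andP.
rewrite Te' lin// Xe Xe' !scalerA lin// Te Te' !scalerDr !scalerA.
rewrite [X in X + _]addrC addrACA -!scalerDl.
rewrite (_ : _ * al + _ = 0) ?scale0r ?add0r; last by ring.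
by congr (_ *: _); rewrite /al /be; field; apply/andP.
Qed.

(** * Forms for which the Hecke operators are self-adjoint *)

Section HeckeForms.
Variables (R : realType) (F : fieldType) (abs : nonarch_abs R F) (t : F).
Hypotheses (t_lt1 : abs t < 1) (t_gt0 : 0 < abs t).
Variable la : intpart.
Local Notation V := (Shat abs la).
Local Notation e := (e_ abs).
Variable T : nat -> V -> V.
Hypothesis T_hecke : forall i : nat, (0 < i)%N -> hecke_op t i (T i).
Implicit Types (tau sigma : syt la) (B : V -> V -> F).

Lemma hecke_swap tau i : (0 < i)%N -> s_up tau i ->
  let d := ctau tau i.+1 - ctau tau i in
  T i (e tau) = e (s_act i tau) + ((1 - t) / (1 - t ^ d)) *: e tau /\
  T i (e (s_act i tau)) = norm_ratio t d *: e tau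
    - (t ^ d * ((1 - t) / (1 - t ^ d))) *: e (s_act i tau).
Proof.
move=> i0 up d; split; first exact: (hecke_up (T_hecke i0)).
have := hecke_down (T_hecke i0) (s_down_swap i0 up).
by rewrite s_actK /ctau box_of_swapl// box_of_swapr.
Qed.

(** [jucys_murphy k] is the operator [Y_(k+1)], up to a power of [t] the usual
    Jucys-Murphy element; without the normalization no division by [t] is
    needed, and the eigenvalue is [t ^ k] times the usual one. *)
Fixpoint jucys_murphy (k : nat) : V -> V :=
  if k is j.+1 then fun v => T k (jucys_murphy j (T k v)) else id.

Lemma jucys_murphy_linear k : linear (jucys_murphy k).
Proof.
elim: k => [//|k IH] a u v /=.
by rewrite (hecke_linear (T_hecke (ltn0Sn k))) IH (hecke_linear (T_hecke (ltn0Sn k))).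
Qed.

Lemma jucys_murphy_eigen k tau :
  jucys_murphy k (e tau) = (t ^ (k%:Z - ctau tau k.+1)) *: e tau.
Proof.
have t0 := t_neq0 t_gt0.
elim: k tau => [|k IH] tau.
  (* The label 1 is in the corner, whose content is 0. *)
  have -> : ctau tau 1 = 0.
    have c1 : tau (corner la) = 1%N.
      have [c|nc] := eqVneq (corner la) (box_of tau 1); first by rewrite c box_ofK.
      have : (tau (corner la) < tau (box_of tau 1))%N.
        by apply: syt_lt => //; apply/eqP.
      by rewrite box_ofK//; have := filling_gt0 tau (corner la); lia.
    by rewrite /ctau -c1 fillingK.
  by rewrite subr0 scale1r.
have i0 := ltn0Sn k; have TZ a v : T k.+1 (a *: v) = a *: T k.+1 v.
  exact: scale_of_linear (hecke_linear (T_hecke i0)).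
(* A downward case for tau is the second half of the upward case for s_i tau,
   so both eigenvalue equations are proved together. *)
have pair sigma : s_up sigma k.+1 ->
    jucys_murphy k.+1 (e sigma) =
      (t ^ (k.+1%:Z - ctau sigma k.+2)) *: e sigma /\
    jucys_murphy k.+1 (e (s_act k.+1 sigma)) =
      (t ^ (k.+1%:Z - ctau sigma k.+1)) *: e (s_act k.+1 sigma).
  move=> up; have d1 := up_gt1 up; set d := _ - _ in d1.
  have [Te Te'] := hecke_swap i0 up.
  have q1 : 1 - t ^ d != 0 by apply: (subr1t_neq0 t_lt1); lia.
  have Xe : jucys_murphy k (e sigma) =
      (t ^ d * t ^ (k%:Z - ctau sigma k.+2)) *: e sigma.
    by rewrite IH -expfzDr// /d; congr (_ ^ _ *: _); ring.
  have Xe' : jucys_murphy k (e (s_act k.+1 sigma)) =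
      (t ^ (k%:Z - ctau sigma k.+2)) *: e (s_act k.+1 sigma).
    by rewrite IH {1}/ctau box_of_swapl.
  have ratioE : norm_ratio t d =
      t * ((1 - t ^ d / t) * (1 - t ^ d * t) / (1 - t ^ d) ^+ 2).
    by rewrite /norm_ratio !expfzDr// expr1z.
  have [] := jucys_murphy_pair (hecke_linear (T_hecke i0)) (@jucys_murphy_linear k)
    t0 q1 Te (etrans Te' (congr1 (fun c => c *: _ - _) ratioE)) Xe Xe'.
  move=> /= -> ->.
  split; congr (_ *: _).
    by rewrite -{1}[t]expr1z -expfzDr//; congr (_ ^ _); lia.
  by rewrite -{1}[t]expr1z -!expfzDr//; congr (_ ^ _); rewrite /d; lia.
case: (adjacentP tau i0) => [r c|cl c|up|dn].
- rewrite /= (hecke_row (T_hecke i0) r) IH TZ (hecke_row (T_hecke i0) r) c.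
  by congr (_ ^ _ *: _); lia.
- have Tc := hecke_col (T_hecke i0) cl.
  rewrite /= Tc (scale_of_linear _ _ (@jucys_murphy_linear k)) IH !TZ Tc !scalerA c.
  rewrite (_ : k.+1%:Z - _ = 1 + (1 + (k%:Z - ctau tau k.+1))); last by lia.
  by rewrite !expfzDr// expr1z; congr (_ *: _); ring.
- by have [] := pair _ up.
- have up := s_up_swap i0 dn; have [_] := pair _ up.
  by rewrite s_actK {1}/ctau -[box_of (s_act _ _) _](box_of_swapr i0 up) s_actK.
Qed.

(** The matrix of [T_i] is block diagonal with blocks of size at most 2, so its
    symmetry has to be checked in the last two cases only. *)
Lemma hecke_offdiag tau sigma i : (0 < i)%N -> sigma != tau ->
  [\/ (T i (e tau) : V) sigma = 0,
      s_up tau i /\ sigma = s_act i tau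
    | s_up sigma i /\ tau = s_act i sigma].
Proof.
move=> i0 ne.
have scaleE (c : F) : (c *: e tau : V) sigma = 0.
  by change (c * (sigma == tau)%:R = 0); rewrite (negbTE ne) mulr0.
case: (adjacentP tau i0) => [r _|c _|up|dn].
- constructor 1; rewrite (hecke_row (T_hecke i0) r) -[e tau]scale1r; exact: scaleE.
- by constructor 1; rewrite (hecke_col (T_hecke i0) c); exact: scaleE.
- have [->|ne'] := eqVneq sigma (s_act i tau); first by constructor 2.
  constructor 1; have [-> _] := hecke_swap i0 up.
  set c := (X in X *: _); rewrite -[LHS]/((sigma == s_act i tau)%:R + (c *: e tau : V) sigma).
  by rewrite scaleE (negbTE ne') addr0.
- have up := s_up_swap i0 dn.
  have [->|ne'] := eqVneq sigma (s_act i tau).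
    by constructor 3; rewrite s_actK.
  constructor 1; have [_] := hecke_swap i0 up; rewrite s_actK => ->.
  set a := norm_ratio _ _; set c := (X in _ - X *: _).
  rewrite -[LHS]/(a * (sigma == s_act i tau)%:R - (c *: e tau : V) sigma).
  by rewrite scaleE (negbTE ne') mulr0 subr0.
Qed.

Section Form.
Variable B : V -> V -> F.
Hypotheses (B_linl : forall w, scalar (B ^~ w)) (B_linr : forall v, scalar (B v)).
Hypothesis B_adj : forall i, (0 < i)%N -> forall v w, B (T i v) w = B v (T i w).

Lemma jucys_murphy_adj k v w : B (jucys_murphy k v) w = B v (jucys_murphy k w).
Proof. by elim: k v w => [//|k IH] v w /=; rewrite B_adj// IH B_adj. Qed.

(** A self-adjoint Jucys-Murphy operator separates the two tableaux by its
    eigenvalues. *)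
Lemma form_orthogonal tau sigma : tau != sigma -> B (e tau) (e sigma) = 0.
Proof.
move=> ne; have [k kP] : exists k, ctau tau k.+1 <> ctau sigma k.+1.
  apply: contrapT => none; move/eqP: ne; apply; apply: contents_inj => -[//|k] _.
  by apply: contrapT => h; apply: none; exists k.
have := jucys_murphy_adj k (e tau) (e sigma); rewrite !jucys_murphy_eigen.
rewrite (scale_of_scalar _ _ (B_linl _)) (scale_of_scalar _ _ (B_linr _)).
move/eqP; rewrite -subr_eq0 -mulrBl mulf_eq0 subr_eq0 => /orP[|/eqP//].
by move=> /eqP/(expt_inj t_lt1 t_gt0) h; exfalso; apply: kP; lia.
Qed.

Hypothesis B_colstd : B (e (colstd la)) (e (colstd la)) = 1.

(** Comparing both sides of [(T_i e_tau, e_(s_i tau)) = (e_tau, T_i e_(s_i tau))]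
    leaves only the squared norms, by orthogonality. *)
Lemma form_norm tau : B (e tau) (e tau) = norm_weight t tau.
Proof.
elim/syt_ind: tau => [|tau i i0 up IH]; first by rewrite norm_weight_colstd.
have := B_adj i0 (e tau) (e (s_act i tau)).
have [-> ->] := hecke_swap i0 up; rewrite norm_weight_swap// -IH.
rewrite addrC B_linl B_linr -scaleNr (scale_of_scalar _ _ (B_linr _)).
by rewrite form_orthogonal 1?eq_sym ?s_up_neq// !mulr0 add0r addr0.
Qed.

Lemma form_basis tau sigma : B (e tau) (e sigma) = norm_weight t tau * (tau == sigma)%:R.
Proof.
have [<-|ne] := eqVneq tau sigma; first by rewrite form_norm mulr1.
by rewrite form_orthogonal// mulr0.
Qed.

End Form.

Hypothesis abs_complete : complete_abs abs.

Local Notation D := (diag_form (abs := abs) (norm_weight t (la:=la))).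

(** By continuity it is enough to compare on basis vectors, where the claim is
    that the matrix of [T_i], with rows weighted by [norm_weight], is symmetric;
    [norm_weight_swap] says exactly this on a block of size 2. *)
Lemma diag_form_adj i : (0 < i)%N -> forall v w : V, D (T i v) w = D v (T i w).
Proof.
move=> i0.
have lT := hecke_linear (T_hecke i0); have cT := hecke_continuous (T_hecke i0).
have Dl := diag_form_linearl abs_complete (norm_weight_le1 t_lt1 (la:=la)).
have Dr := diag_form_linearr abs_complete (norm_weight_le1 t_lt1 (la:=la)).
have cD := diag_form_continuous abs_complete (norm_weight_le1 t_lt1 (la:=la)).
suff E : (fun v w : V => D (T i v) w) = (fun v w => D v (T i w)).
  by move=> v w; exact: (congr1 (fun B => B v w) E).
apply: (@bilinear_ext _ _ abs (syt la)).
- by move=> w a u v; rewrite lT [LHS]Dl.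
- by move=> v; exact: Dr.
- by move=> w; exact: Dl.
- by move=> v a u w; rewrite lT Dr.
- move=> w; exact: continuous_fun_comp (continuous_form_l _ cD) cT.
- move=> v; exact: continuous_form_r cD.
- move=> w; exact: continuous_form_l cD.
- move=> v; exact: continuous_fun_comp (continuous_form_r _ cD) cT.
move=> tau sigma; rewrite [RHS]diag_form_sym !diag_form_delta.
have [->//|ne] := eqVneq sigma tau.
have swap rho : s_up rho i -> norm_weight t (s_act i rho) * (T i (e rho) : V) (s_act i rho) =
    norm_weight t rho * (T i (e (s_act i rho)) : V) rho.
  move=> up; have [-> ->] := hecke_swap i0 up; rewrite norm_weight_swap//.
  set a := norm_ratio _ _; set b := (X in _ + X *: _); set c := (X in _ - X *: _).
  rewrite -[(_ + _ : V) _]/((s_act i rho == s_act i rho)%:R + b * (s_act i rho == rho)%:R).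
  rewrite -[(_ - _ : V) _]/(a * (rho == rho)%:R - c * (rho == s_act i rho)%:R).
  rewrite !eqxx [rho == _]eq_sym (negbTE (s_up_neq i0 up)) !mulr0 subr0 addr0 !mulr1.
  exact: mulrC.
have ne' : tau != sigma by rewrite eq_sym.
case: (hecke_offdiag i0 ne) => [z|[up ->]|[up ->]]; [|exact: swap|exact/esym/swap].
case: (hecke_offdiag i0 ne') => [z'|[up ->]|[up ->]]; [|exact/esym/swap|exact: swap].
by rewrite [X in _ * X]z [X in _ = _ * X]z' !mulr0.
Qed.

End HeckeForms.

Theorem theorem4p6 (R : realType) (F : fieldType) (abs : nonarch_abs R F)
    (abs_nontriv : nontrivial_abs abs) (abs_complete : complete_abs abs)
    (t : F) (t_gt0 : 0 < abs t) (t_lt1 : abs t < 1) (la : intpart)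
    (T : nat -> Shat abs la -> Shat abs la)
    (T_hecke : forall i : nat, (0 < i)%N -> hecke_op t i (T i)) :
  exists! B : Shat abs la -> Shat abs la -> F,
    [/\ inner_product abs (@Shat_norm R F abs la) B,
        B (e_ abs (colstd la)) (e_ abs (colstd la)) = 1
      & forall i : nat, (0 < i)%N ->
          forall v w : Shat abs la, B (T i v) w = B v (T i w)].
Proof.
have a1 := norm_weight_le1 t_lt1 (la:=la).
have ipD := diag_form_inner_product abs_complete a1 (norm_weight_neq0 t_lt1 t_gt0 (la:=la)).
have D1 : diag_form (abs := abs) (norm_weight t (la:=la))
    (e_ abs (colstd la)) (e_ abs (colstd la)) = 1.
  by rewrite diag_form_delta norm_weight_colstd mul1r /= eqxx.
have adjD := diag_form_adj t_lt1 T_hecke abs_complete.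
exists (diag_form (abs := abs) (norm_weight t (la:=la))); split=> // B [[Bl Br _ _ cB] B1 adjB].
have [Dl Dr _ _ cD] := ipD.
apply: (@bilinear_ext _ _ abs (syt la)) => //.
- by move=> w; exact: continuous_form_l cD.
- by move=> w; exact: continuous_form_r cD.
- by move=> w; exact: continuous_form_l cB.
- by move=> w; exact: continuous_form_r cB.
move=> tau sigma.
by rewrite [LHS](form_basis t_lt1 t_gt0 T_hecke Dl Dr adjD D1)
  [RHS](form_basis t_lt1 t_gt0 T_hecke Bl Br adjB B1).
Qed.
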